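(* Let $X$ be a real Hilbert space, let $A,B\colon X\rightrightarrows X$ be maximally $\alpha$-monotone and maximally $\beta$-monotone, respectively, with $\alpha+\beta>0$, let $C\colon X\to X$ be $\sigma$-cocoercive, and let $\gamma,\delta>0$ satisfy $$\eta^*:=\frac{4\gamma\delta(1+\gamma\alpha)(1+\delta\beta)-(\gamma+\delta)^2}{2\gamma\delta^2(\alpha+\beta)}-\frac{\gamma}{2\sigma}>0.$$ Set $\lambda:=1+\frac\delta\gamma$, let $\eta>0$, set $S:=(1-\lambda)\mathrm{Id}+\lambda J_{\gamma A}-\delta CJ_{\gamma A}$ and $T_{A,B,C}:=\mathrm{Id}-\eta J_{\gamma A}+\eta J_{\delta B}S$. Let $x_0\in X$ and $x_{n+1}:=T_{A,B,C}x_n$. Then: (i) $T_{A,B,C}$ is single-valued and has full domain. (ii) For all $x,y\in X$, writing $T=T_{A,B,C}$, $$\|Tx-Ty\|^2\le\|x-y\|^2-\Big(\frac{\eta^*}{\eta}-1\Big)\|(\mathrm{Id}-T)x-(\mathrm{Id}-T)y\|^2-\frac{\gamma}{2\eta\sigma}\|(\mathrm{Id}-T)x-(\mathrm{Id}-T)y-2\eta\sigma(CJ_{\gamma A}x-CJ_{\gamma A}y)\|^2$$ $$\qquad-\frac{\gamma\eta}{2\delta^2(\alpha+\beta)}\|(\lambda-2+2\delta\alpha)(J_{\gamma A}x-J_{\gamma A}y)+(2-\lambda+2\delta\beta)(J_{\delta B}Sx-J_{\delta B}Sy)\|^2.$$ In particular, $T_{A,B,C}$ is conically $\frac{\eta}{\eta^*}$-averaged.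 (iii) If $\operatorname{zer}(A+B+C)\neq\varnothing$ and $\eta<\eta^*$, then $\|x_n-T_{A,B,C}x_n\|=o(1/\sqrt n)$, $(x_n)$ converges weakly to some $x^*\in\operatorname{Fix}T_{A,B,C}$, $(J_{\gamma A}x_n)$ and $(J_{\delta B}Sx_n)$ converge strongly to $J_{\gamma A}x^*=J_{\delta B}Sx^*\in\operatorname{zer}(A+B+C)$, $(CJ_{\gamma A}x_n)$ converges strongly to $CJ_{\gamma A}x^*$, and $\operatorname{zer}(A+B+C)=\{J_{\gamma A}x^*\}$.
   Context: For $A\colon X\rightrightarrows X$, $J_A:=(\mathrm{Id}+A)^{-1}$, $\operatorname{zer}A:=\{x:0\in Ax\}$. $A$ is $\alpha$-monotone ($\alpha\in\mathbb R$) if $\langle x-y,u-v\rangle\ge\alpha\|x-y\|^2$ for all $(x,u),(y,v)\in\operatorname{gra}A$; maximally $\alpha$-monotone if moreover no $\alpha$-monotone operator has a graph properly containing $\operatorname{gra}A$. $C$ is $\sigma$-cocoercive ($\sigma>0$) if $\langle x-y,Cx-Cy\rangle\ge\sigma\|Cx-Cy\|^2$ for all $x,y$. $T$ is conically $\theta$-averaged ($\theta>0$) if $T=(1-\theta)\mathrm{Id}+\theta N$ with $N$ nonexpansive. $\operatorname{Fix}T=\{x:Tx=x\}$. *)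

(* Defs.v *)
(* A real Hilbert space is modelled as a complete
   normed module V over a realType R, together with an inner product ip whose
   induced norm is the norm of V. Set-valued operators are graphs V -> V -> Prop. *)
From HB Require Import structures.
From mathcomp Require Import all_boot all_order all_algebra.
From mathcomp Require Import all_classical all_reals all_analysis.
Set Implicit Arguments. Unset Strict Implicit. Unset Printing Implicit Defensive.
Import Order.TTheory GRing.Theory Num.Theory.
Import numFieldNormedType.Exports.
Local Open Scope classical_set_scope.
Local Open Scope ring_scope.

Section Defs.
Variables (R : realType) (V : completeNormedModType R).

Definition is_inner_product (ip : V -> V -> R) : Prop :=
  [/\ (forall x y, ip x y = ip y x),
      (forall (a : R) x y z, ip (a *: x + y) z = a * ip x z + ip y z) &
      (forall x, ip x x = `|x| ^+ 2)].

(* set-valued operators, represented by their graphs: op x u  <->  u \in op x *)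
Definition op := V -> V -> Prop.

Definition fun_op (f : V -> V) : op := fun x u => u = f x.
Definition Id_op : op := fun_op id.
Definition op_add (A B : op) : op :=
  fun x z => exists a b, A x a /\ B x b /\ z = a + b.
Definition op_scale (c : R) (A : op) : op :=
  fun x z => exists a, A x a /\ z = c *: a.
Definition op_comp (A B : op) : op := fun x z => exists y, B x y /\ A y z.

(* resolvent J_{g A} = (Id + g A)^{-1} *)
Definition resolvent (g : R) (A : op) : op :=
  fun x p => exists u, A p u /\ x = p + g *: u.

Definition zer (A : op) : set V := fun x => A x 0.
Definition Fix (T : op) : set V := fun x => T x x.

Definition alpha_monotone (ip : V -> V -> R) (alpha : R) (A : op) : Prop :=
  forall x u y v, A x u -> A y v -> alpha * `|x - y| ^+ 2 <= ip (x - y) (u - v).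

Definition max_alpha_monotone (ip : V -> V -> R) (alpha : R) (A : op) : Prop :=
  alpha_monotone ip alpha A /\
  forall A' : op, alpha_monotone ip alpha A' ->
    (forall x u, A x u -> A' x u) -> forall x u, A' x u -> A x u.

Definition cocoercive (ip : V -> V -> R) (sigma : R) (C : V -> V) : Prop :=
  0 < sigma /\ forall x y, sigma * `|C x - C y| ^+ 2 <= ip (x - y) (C x - C y).

Definition nonexpansive (N : V -> V) : Prop :=
  forall x y, `|N x - N y| <= `|x - y|.

Definition conically_averaged (theta : R) (T : op) : Prop :=
  0 < theta /\ exists N : V -> V, nonexpansive N /\
    forall x y, T x y <-> y = (1 - theta) *: x + theta *: N x.

Definition single_valued_full_domain (T : op) : Prop :=
  forall x, exists! y, T x y.

Definition weak_cvg (ip : V -> V -> R) (u : nat -> V) (l : V) : Prop :=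
  forall y, (fun n => ip (u n) y) @ \oo --> ip l y.

Definition S_op (g d : R) (A : op) (C : V -> V) : op :=
  let lam := 1 + d / g in
  op_add (op_add (op_scale (1 - lam) Id_op) (op_scale lam (resolvent g A)))
         (op_scale (- d) (op_comp (fun_op C) (resolvent g A))).

Definition T_op (g d eta : R) (A B : op) (C : V -> V) : op :=
  op_add (op_add Id_op (op_scale (- eta) (resolvent g A)))
         (op_scale eta (op_comp (resolvent d B) (S_op g d A C))).

End Defs.

(* Main.v *)
(* (i) Positivity of [eta_star] forces [1 + gamma alpha > 0] and
   [1 + delta beta > 0], so both resolvents are everywhere defined by Minty's
   theorem. The latter follows by minimizing a strongly convex function over a
   convex hull of the graph, where Cauchy minimizing sequences replace weak
   compactness.
   (ii) The inequality is an exact identity up to a positive combination of the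
   monotonicity of [A] and [B] and the cocoercivity of [C].
   (iii) Every zero is the shadow of a fixed point [f]; telescoping (ii) against
   [f] makes all the square terms on the right tend to [0], which gives the rate
   and the strong limits. For the weak limit, each infinite set [E] of indices
   has an asymptotic center, the minimizer of [limsup_{n in E} |x_n - b|^2]; it
   is a fixed point of [T] and satisfies [l + |b - c|^2 <= limsup |x_n - b|^2],
   so all these centers coincide, and moving the center in a direction along
   which [x_n - c] does not tend weakly to [0] would decrease the limsup. *)
Require Import Defs.
From HB Require Import structures.
From mathcomp Require Import all_boot all_order all_algebra.
From mathcomp Require Import all_classical all_reals all_analysis.
From mathcomp Require Import ring lra.
Set Implicit Arguments.
Unset Strict Implicit.
Unset Printing Implicit Defensive.
Import Order.TTheory GRing.Theory Num.Theory.
Import numFieldNormedType.Exports.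
Local Open Scope classical_set_scope.
Local Open Scope ring_scope.

(** * Real sequences and the sign of the resolvent constants *)

Lemma cvgn_distP (R : realType) (V : pseudoMetricNormedZmodType R)
    (u : nat -> V) (l : V) :
  u @ \oo --> l <->
  forall e : R, 0 < e -> exists N, forall n, (N <= n)%N -> `|u n - l| < e.
Proof.
split=> [/cvgrPdist_lt h e e0 | h].
  have [N _ hN] := h e e0; exists N => n Nn.
  by rewrite distrC; apply: hN.
apply/cvgrPdist_lt => e e0; have [N hN] := h e e0.
by exists N => // n /= Nn; rewrite distrC; apply: hN.
Qed.

(** The same expression as [etastar] in the theorem, so that results about it apply there by
    conversion. *)
Definition eta_star {R : realType} (alpha beta sigma gamma delta : R) : R :=
  (4 * gamma * delta * (1 + gamma * alpha) * (1 + delta * beta)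
     - (gamma + delta) ^+ 2) / (2 * gamma * delta ^+ 2 * (alpha + beta))
  - gamma / (2 * sigma).

(* [eta_star > 0] makes the two factors have the same sign, and
   [(1 + gamma alpha) / gamma + (1 + delta beta) / delta > 0]. *)
Lemma eta_star_gt0 (R : realType) (alpha beta sigma gamma delta : R) :
  0 < alpha + beta -> 0 < sigma -> 0 < gamma -> 0 < delta ->
  0 < eta_star alpha beta sigma gamma delta ->
  0 < 1 + gamma * alpha /\ 0 < 1 + delta * beta.
Proof.
move=> ab0 s0 g0 d0; rewrite /eta_star subr_gt0 => h.
have {h}: 0 < (4 * gamma * delta * (1 + gamma * alpha) * (1 + delta * beta)
     - (gamma + delta) ^+ 2) / (2 * gamma * delta ^+ 2 * (alpha + beta)).
  by apply: lt_trans h; rewrite divr_gt0 // mulr_gt0.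
rewrite pmulr_lgt0; last first.
  by rewrite invr_gt0 !mulr_gt0 // exprn_gt0.
set a := 1 + gamma * alpha; set b := 1 + delta * beta => h.
have gd0 : 0 < 4 * gamma * delta by rewrite !mulr_gt0.
have ab : 0 < a * b.
  have := sqr_ge0 (gamma + delta) => h2.
  have : 0 < 4 * gamma * delta * (a * b) by lra.
  by rewrite pmulr_rgt0.
have sum : 0 < delta * a + gamma * b.
  have := mulr_gt0 (mulr_gt0 g0 d0) ab0; rewrite /a /b; lra.
have [a0|a0|a0] := ltgtP 0 a.
- by split=> //; rewrite -(pmulr_rgt0 _ a0).
- have b0 : b < 0 by rewrite -(nmulr_rgt0 _ a0).
  have := mulr_gt0 d0 (_ : 0 < - a); have := mulr_gt0 g0 (_ : 0 < - b); lra.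
- by rewrite -a0 mul0r ltxx in ab.
Qed.

(** The sequence [a] is nonincreasing and bounded below, so it converges, and [k * r n ^+ 2] is at
    most [a n - limn a]. *)
Lemma cvg0_of_gap (R : realType) (a r : nat -> R) (k : R) :
  0 < k -> (forall n, 0 <= a n) -> (forall n, 0 <= r n) ->
  (forall n, k * r n ^+ 2 <= a n - a n.+1) -> r @ \oo --> 0.
Proof.
move=> k0 a0 r0 gap.
have dec : {homo a : n m / (n <= m)%N >-> m <= n}.
  apply/nonincreasing_seqP => n; rewrite -subr_ge0.
  by apply: le_trans (gap n); rewrite mulr_ge0 ?sqr_ge0 // ltW.
have cv : cvgn a.
  by apply: nonincreasing_is_cvgn => //; exists 0 => _ [n _ <-].
have la := nonincreasing_cvgn_ge dec cv.
apply/cvgn_distP => e e0.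
have ke0 : 0 < k * e ^+ 2 by rewrite mulr_gt0 // exprn_gt0.
have /cvgn_distP/(_ _ ke0)[N hN] : a @ \oo --> limn a by [].
exists N => n /hN; rewrite ltr_norml => /andP[_ aN].
rewrite subr0 ger0_norm // -(ltr_pXn2r (_ : 0 < 2)%N) ?nnegrE ?(ltW e0) //.
rewrite -(ltr_pM2l k0).
by have := gap n; have := la n.+1; lra.
Qed.

(* Since [r] is nonincreasing, [k (n - N) r_n^2 <= a_N - a_n], which is small
   for large [N]; take [n >= 2 N]. *)
Lemma sqrt_rate_of_gap (R : realType) (a r : nat -> R) (k : R) :
  0 < k -> (forall n, 0 <= a n) -> (forall n, 0 <= r n) ->
  (forall n, r n.+1 <= r n) ->
  (forall n, k * r n ^+ 2 <= a n - a n.+1) ->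
  (fun n => Num.sqrt n%:R * r n) @ \oo --> 0.
Proof.
move=> k0 a0 r0 rdec gap.
have dec : {homo a : n m / (n <= m)%N >-> m <= n}.
  apply/nonincreasing_seqP => n; rewrite -subr_ge0.
  by apply: le_trans (gap n); rewrite mulr_ge0 ?sqr_ge0 // ltW.
have cv : cvgn a.
  by apply: nonincreasing_is_cvgn => //; exists 0 => _ [n _ <-].
have la := nonincreasing_cvgn_ge dec cv.
have sum N j : k * j%:R * r (N + j)%N ^+ 2 <= a N - a (N + j)%N.
  elim: j => [|j IH]; first by rewrite mulr0 mul0r addn0 subrr.
  have rr : r (N + j.+1)%N ^+ 2 <= r (N + j)%N ^+ 2.
    by rewrite lerXn2r ?nnegrE // addnS.
  have : k * j.+1%:R * r (N + j.+1)%N ^+ 2 <= k * j.+1%:R * r (N + j)%N ^+ 2.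
    by rewrite ler_wpM2l // mulr_ge0 // ltW.
  have := gap (N + j)%N; rewrite addnS -natr1; lra.
apply/cvgn_distP => e e0.
have ke0 : 0 < k * e ^+ 2 / 2 by rewrite divr_gt0 // mulr_gt0 // exprn_gt0.
have /cvgn_distP/(_ _ ke0)[N hN] : a @ \oo --> limn a by [].
exists (N + N)%N => n Nn.
have /subnKC nE : (N <= n)%N by apply: leq_trans Nn; exact: leq_addr.
have Nj : (N <= n - N)%N by rewrite leq_subRL // -nE leq_addr.
have := sum N (n - N)%N; have := hN N (leqnn N); rewrite nE.
rewrite ltr_norml => /andP[_ aN] kr.
rewrite subr0 ger0_norm ?mulr_ge0 ?sqrtr_ge0 //.
rewrite -(ltr_pXn2r (_ : 0 < 2)%N) ?nnegrE ?mulr_ge0 ?sqrtr_ge0 ?(ltW e0) //.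
rewrite exprMn sqr_sqrtr // -(ltr_pM2l k0).
have : n%:R <= 2 * (n - N)%:R :> R.
  by rewrite -natrM ler_nat -{1}nE mul2n -addnn leq_add2r.
move=> /(ler_wpM2r (sqr_ge0 (r n)))/(ler_wpM2l (ltW k0)).
have := la n; lra.
Qed.

(** * Operators that are graphs of everywhere defined functions *)

Section FunctionalOperators.
Context {R : realType} {V : completeNormedModType R}.

Definition has_graph (f : V -> V) (F : op V) := forall x y, F x y <-> y = f x.

Lemma has_graph_add f g F G : has_graph f F -> has_graph g G ->
  has_graph (fun x => f x + g x) (op_add F G).
Proof.
move=> hf hg x y; split=> [[a [b [/hf -> [/hg -> ->]]]] //|->].
by exists (f x), (g x); rewrite hf hg.
Qed.

Lemma has_graph_scale c f F : has_graph f F ->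
  has_graph (fun x => c *: f x) (op_scale c F).
Proof.
move=> hf x y; split=> [[a [/hf -> ->]] //|->].
by exists (f x); rewrite hf.
Qed.

Lemma has_graph_comp f g F G : has_graph f F -> has_graph g G ->
  has_graph (fun x => f (g x)) (op_comp F G).
Proof.
move=> hf hg x y; split=> [[a [/hg -> /hf]] //|->].
by exists (g x); rewrite hf hg.
Qed.

End FunctionalOperators.

(** * Inner product calculus *)

Section InnerProduct.
Context {R : realType} {V : completeNormedModType R} {ip : V -> V -> R}.
Hypothesis hip : is_inner_product ip.

Lemma ipC x y : ip x y = ip y x.
Proof. by case: hip. Qed.

Lemma ip0l z : ip 0 z = 0.
Proof.
case: hip => _ h _.
have := h 1 0 0 z; rewrite scaler0 add0r mul1r => /eqP.
by rewrite addrC -subr_eq subrr eq_sym => /eqP.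
Qed.

Lemma ipDl x y z : ip (x + y) z = ip x z + ip y z.
Proof. by case: hip => _ h _; rewrite -{1}[x]scale1r h mul1r. Qed.

Lemma ipZl a x z : ip (a *: x) z = a * ip x z.
Proof. by case: hip => _ h _; rewrite -[a *: x]addr0 h ip0l addr0. Qed.

Lemma ipNl x z : ip (- x) z = - ip x z.
Proof. by rewrite -scaleN1r ipZl mulN1r. Qed.

Lemma ipDr x y z : ip z (x + y) = ip z x + ip z y.
Proof. by rewrite ipC ipDl !(ipC z). Qed.

Lemma ipZr a x z : ip z (a *: x) = a * ip z x.
Proof. by rewrite ipC ipZl (ipC z). Qed.

Lemma ipNr x z : ip z (- x) = - ip z x.
Proof. by rewrite ipC ipNl (ipC z). Qed.

Lemma ip0r z : ip z 0 = 0.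
Proof. by rewrite ipC ip0l. Qed.

Lemma sqr_normE x : `|x| ^+ 2 = ip x x.
Proof. by case: hip => _ _ ->. Qed.

Definition ipE := (ipDl, ipDr, ipNl, ipNr, ipZl, ipZr, ip0l, ip0r).

Lemma ip_ge0 x : 0 <= ip x x.
Proof. by rewrite -sqr_normE sqr_ge0. Qed.

(** Turns a vector identity into a scalar one, which [ipE] expands and [ring] or [field] decides. *)
Lemma ip_ext x y : (forall z, ip x z = ip y z) -> x = y.
Proof.
move=> h; apply/eqP; rewrite -subr_eq0 -normr_eq0 -sqrf_eq0 sqr_normE.
by rewrite ipDl ipNl h subrr.
Qed.

Lemma sqr_norm_convex (t : R) (b c : V) :
  `|(1 - t) *: b + t *: c| ^+ 2 =
  (1 - t) * `|b| ^+ 2 + t * `|c| ^+ 2 - t * (1 - t) * `|b - c| ^+ 2.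
Proof. by rewrite !sqr_normE !ipE (ipC c b); ring. Qed.

(** * Strongly convex minimization, Minty's theorem and resolvents *)

(** [K b f] reads: [f] is an admissible value at [b]. As [K] is not assumed closed, [c] is the limit
    of a minimizing sequence, and the infimum [m] is approached but not claimed to be attained at
    [c]. *)
Lemma strongly_convex_min (K : V -> R -> Prop) (l : R) :
  (forall b f c g (t : R), 0 <= t <= 1 -> K b f -> K c g ->
     K ((1 - t) *: b + t *: c)
       ((1 - t) * f + t * g - t * (1 - t) * `|b - c| ^+ 2)) ->
  (exists b f, K b f) -> (forall b f, K b f -> l <= f) ->
  exists c m, (forall b f, K b f -> m + `|b - c| ^+ 2 <= f) /\
    (forall e : R, 0 < e -> exists b f, K b f /\ f < m + e).
Proof.
move=> hK [b0 [f0 K0]] hl.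
pose E := [set f | exists b, K b f].
have hE : has_inf E.
  split; first by exists f0, b0.
  by exists l => f [b /hl].
set m := inf E.
have mE b f : K b f -> m <= f by move=> Kb; apply: ge_inf; [case: hE | exists b].
have happ (e : R) : 0 < e -> exists b f, K b f /\ f < m + e.
  by move=> e0; have [f [b Kb] fm] := inf_adherent e0 hE; exists b, f.
have harm_gt0 n : 0 < harmonic n :> R by rewrite /= invr_gt0 ltr0n.
have /choice[bf hbf] n : exists bf : V * R, K bf.1 bf.2 /\ bf.2 < m + harmonic n.
  by have [b [f]] := happ _ (harm_gt0 n); exists (b, f).
pose b n := (bf n).1; pose f n := (bf n).2.
have Kbf n : K (b n) (f n) by case: (hbf n).
have fm n : f n < m + harmonic n by case: (hbf n).
have half01 : 0 <= (2^-1 : R) <= 1 by lra.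
(* The midpoint of two near-minimizers has value at least [m], which bounds their distance. *)
have mid n k : `|b n - b k| ^+ 2 <= 2 * (harmonic n + harmonic k).
  have := mE _ _ (hK _ _ _ _ _ half01 (Kbf n) (Kbf k)).
  move: (fm n) (fm k) (`|_| ^+ 2) => + + D; move: (harmonic n) (harmonic k) => u v.
  lra.
have small (e : R) : 0 < e -> exists N, forall n, (N <= n)%N -> harmonic n < e.
  move=> e0; have /cvgn_distP/(_ _ e0)[N hN] := @cvg_harmonic R.
  by exists N => n /hN; rewrite subr0 gtr0_norm.
have hC : cauchy (b @ \oo).
  apply/cauchy_exP => e e0.
  have [|N hN] := small (e ^+ 2 / 4); first by rewrite divr_gt0 ?exprn_gt0.
  exists (b N), N => // n /= Nn; rewrite -ball_normE /=.
  rewrite -(ltr_pXn2r (_ : 0 < 2)%N) ?nnegrE ?(ltW e0) //.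
  apply: le_lt_trans (mid _ _) _; have := hN _ Nn; have := hN _ (leqnn _).
  by move: (harmonic n) (harmonic N) => u v; lra.
have bc : cvg (b @ \oo) by apply/cauchy_cvgP.
set c := lim (b @ \oo) in bc.
exists c, m; split=> // d g Kdg.
rewrite -lerBrDl.
have D0 : 0 <= `|d - c| ^+ 2 by rewrite sqr_ge0.
(* Compare with the point at parameter [t] between [b n] and [d], divide by [t] and let [n] grow;
   afterwards [t] is taken small. *)
have lim_le (t : R) : 0 < t -> t < 1 -> (1 - t) * `|d - c| ^+ 2 <= g - m.
  move=> t0 t1.
  have cv : (fun n => (1 - t) * (`|d - b n| * `|d - b n|)
        - ((1 - t) / t) * harmonic n)
      @ \oo --> (1 - t) * (`|d - c| * `|d - c|) - ((1 - t) / t) * 0.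
    have cn : (fun n => `|d - b n|) @ \oo --> `|d - c|.
      by apply: cvg_norm; apply: cvgB => //; exact: cvg_cst.
    apply: cvgB; apply: cvgM; try exact: cvg_cst; last exact: cvg_harmonic.
    exact: cvgM.
  rewrite mulr0 subr0 in cv.
  apply: (ler_cvg_to cv (cvg_cst (g - m))).
  near=> n.
  have t01 : 0 <= t <= 1 by lra.
  have := mE _ _ (hK _ _ _ _ _ t01 (Kbf n) Kdg).
  rewrite distrC -expr2; have := fm n.
  move: (`|_| ^+ 2) (harmonic n) (f n) => D h fn fh H.
  rewrite -(ler_pM2l t0).
  have -> : t * ((1 - t) * D - (1 - t) / t * h) = t * (1 - t) * D - (1 - t) * h.
    by field; rewrite gt_eqF.
  have : (1 - t) * fn <= (1 - t) * (m + h) by rewrite ler_wpM2l; lra.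
  lra.
apply/ler_addgt0Pr => e e0.
have De : 0 < `|d - c| ^+ 2 + e + 1 by lra.
(* This [t] is below 1 and makes [t] times the squared distance at most [e]. *)
have := lim_le (e / (`|d - c| ^+ 2 + e + 1)).
rewrite divr_gt0 // ltr_pdivrMr // => /(_ isT).
have -> : e < 1 * (`|d - c| ^+ 2 + e + 1) by lra.
move=> /(_ isT) H.
have : e / (`|d - c| ^+ 2 + e + 1) * `|d - c| ^+ 2 <= e.
  by rewrite mulrAC ler_pdivrMr // ler_pM2l //; lra.
lra.
Unshelve. all: end_near. Qed.

(** Minty's theorem for the resolvent at 0, before maximality puts the pair [(p, - p)] into the
    graph. Other points reduce to it by an affine change of operator. *)
Lemma minty_point (M : V -> V -> Prop) :
  (forall x u y v, M x u -> M y v -> 0 <= ip (x - y) (u - v)) ->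
  exists p, forall y v, M y v -> 0 <= ip (p - y) (- p - v).
Proof.
move=> mono.
have [[y0 [v0 M0]]|noM] := pselect (exists y v, M y v); last first.
  by exists 0 => y v Myv; case: noM; exists y, v.
(* [K0] is the epigraph of the Fitzpatrick function of [M] and [K] its polar for
   the same pairing: a convex set containing [(y, v, ip y v)] for [M y v] and
   contained in [K0], so that [ip y v <= s] on [K]. *)
pose K0 y v s := forall y' v', M y' v' ->
  0 <= s + ip y' v' - ip y v' - ip y' v.
pose K y v s := forall y' v' s', K0 y' v' s' ->
  0 <= s + s' - ip y v' - ip y' v.
have MK0 y v : M y v -> K0 y v (ip y v).
  by move=> Myv y' v' /(mono _ _ _ _ Myv); rewrite !ipE; lra.
have MK y v : M y v -> K y v (ip y v).
  by move=> Myv y' v' s' /(_ _ _ Myv); lra.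
have K_ge y v s : K y v s -> ip y v <= s.
  move=> Ks; have : K0 y v s by move=> y' v' /MK0 /Ks.
  by move=> /Ks; lra.
(* Since [s] is at least [ip y v], [f] is at least [|y + v|^2 / 4], hence nonnegative; the square of
   [b] provides the strong convexity. *)
pose L b f := exists y v s, [/\ K y v s, b = 2^-1 *: (y - v) & f = `|b| ^+ 2 + s].
have [|||c [m [cm mapp]]] := @strongly_convex_min L 0.
- move=> b f c g t /andP[t0 t1] [y [v [s [Ks -> ->]]]] [z [w [r [Kr -> ->]]]].
  exists ((1 - t) *: y + t *: z), ((1 - t) *: v + t *: w), ((1 - t) * s + t * r).
  split; last by rewrite sqr_norm_convex; ring.
    move=> y' v' s' K'; rewrite !ipE.
    have H1 : 0 <= (1 - t) * (s + s' - ip y v' - ip y' v).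
      by apply: mulr_ge0; [lra | exact: Ks].
    have H2 : 0 <= t * (r + s' - ip z v' - ip y' w).
      by apply: mulr_ge0 => //; exact: Kr.
    lra.
  by apply: ip_ext => z'; rewrite !ipE; ring.
- by do 2 eexists; exists y0, v0, (ip y0 v0); split; [exact: MK | |].
- move=> b f [y [v [s [/K_ge Ks -> ->]]]].
  rewrite sqr_normE !ipE (ipC v y).
  by have := ip_ge0 (y + v); rewrite !ipE (ipC v y); lra.
have m0 : 0 <= m.
  apply/ler_addgt0Pr => e /mapp[b [f [[y [v [s [/K_ge Ks -> ->]]]]]]].
  rewrite sqr_normE !ipE (ipC v y).
  by have := ip_ge0 (y + v); rewrite !ipE (ipC v y); lra.
(* On the graph, [|b|^2 + ip y v >= |b - c|^2] with [b = (y - v) / 2] rearranges exactly to the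
   goal. *)
exists c => y v Myv.
have /cm : L (2^-1 *: (y - v)) (`|2^-1 *: (y - v)| ^+ 2 + ip y v).
  by exists y, v, (ip y v); split=> //; exact: MK.
by rewrite !sqr_normE !ipE (ipC v y) (ipC c y) (ipC c v); lra.
Qed.

Lemma resolvent_ex (g alpha : R) (A : op V) w :
  max_alpha_monotone ip alpha A -> 0 < g -> 0 < 1 + g * alpha ->
  exists p, resolvent g A w p.
Proof.
move=> [mono maxA] g0 c0; set c := 1 + g * alpha in c0.
(* The shift by [alpha] makes [M] monotone, and [- p] in [M p] means [w = p + g u] with [u] in
   [A p]. *)
pose M y v := exists2 u, A y u & v = c^-1 *: (g *: (u - alpha *: y) - w).
have [|p hp] := @minty_point M.
  move=> x _ y _ [u Axu ->] [v Ayv ->].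
  have := mono _ _ _ _ Axu Ayv; rewrite sqr_normE => H.
  have -> : ip (x - y) (c^-1 *: (g *: (u - alpha *: x) - w) -
      c^-1 *: (g *: (v - alpha *: y) - w)) =
    c^-1 * g * (ip (x - y) (u - v) - alpha * ip (x - y) (x - y)).
    by rewrite !ipE; ring.
  by rewrite mulr_ge0 ?subr_ge0 // mulr_ge0 ?ltW // invr_gt0.
pose u := g^-1 *: (w - p).
exists p, u; split; last by rewrite scalerA divff ?gt_eqF // scale1r addrC subrK.
have key y v : A y v -> alpha * `|p - y| ^+ 2 <= ip (p - y) (u - v).
  move=> Ayv; have : M y (c^-1 *: (g *: (v - alpha *: y) - w)) by exists v.
  move=> /hp H; rewrite -subr_ge0 sqr_normE.
  have -> : ip (p - y) (u - v) - alpha * ip (p - y) (p - y) =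
     g^-1 * c * ip (p - y) (- p - c^-1 *: (g *: (v - alpha *: y) - w)).
    rewrite /u !ipE (ipC y p) /c; field.
    by rewrite !gt_eqF.
  by rewrite mulr_ge0 // mulr_ge0 ?ltW // invr_gt0.
(* Adjoining the pair [(p, u)] preserves [alpha]-monotonicity, so maximality puts it into [A]. *)
apply: (maxA (fun y v => A y v \/ (y = p /\ v = u))); last 2 first.
- by move=> y v; left.
- by right.
move=> y v z v' [Ayv|[-> ->]] [Azv|[-> ->]].
- exact: mono.
- by have := key _ _ Ayv; rewrite !sqr_normE !ipE (ipC y p); lra.
- exact: key.
- by rewrite !subrr normr0 ip0l expr0n mulr0.
Qed.

Lemma resolvent_monotone (g alpha : R) (A : op V) x y p q :
  alpha_monotone ip alpha A -> 0 < g ->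
  resolvent g A x p -> resolvent g A y q ->
  (1 + g * alpha) * `|p - q| ^+ 2 <= ip (p - q) (x - y).
Proof.
move=> mono g0 [u [Apu ->]] [v [Aqv ->]].
have := mono _ _ _ _ Apu Aqv; rewrite -(ler_pM2l g0) !sqr_normE.
by rewrite !ipE; lra.
Qed.

Lemma resolventE (g alpha : R) (A : op V) :
  max_alpha_monotone ip alpha A -> 0 < g -> 0 < 1 + g * alpha ->
  exists J : V -> V, forall x p, resolvent g A x p <-> p = J x.
Proof.
move=> maxA g0 c0.
have /choice[J hJ] x := resolvent_ex x maxA g0 c0.
exists J => x p; split=> [Jp|-> //].
have := resolvent_monotone maxA.1 g0 Jp (hJ x).
rewrite subrr ip0r pmulr_rle0 // => H.
apply/eqP; rewrite -subr_eq0 -normr_eq0 -sqrf_eq0 eq_le H; exact: sqr_ge0.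
Qed.

(** * The main inequality and conical averagedness *)

(* The gap between the two sides is [eta] times twice the sum of the slacks of
   the three hypotheses with weights [1], [gamma / delta] and [gamma]; the
   weight [gamma / delta] cancels the scalar products of [a] with [q]. *)
Lemma splitting_ineq (alpha beta sigma gamma delta eta : R) (a p q c : V) :
  0 < alpha + beta -> 0 < sigma -> 0 < gamma -> 0 < delta -> 0 < eta ->
  (1 + gamma * alpha) * `|p| ^+ 2 <= ip p a ->
  (1 + delta * beta) * `|q| ^+ 2 <=
    ip q (- (delta / gamma) *: a + (1 + delta / gamma) *: p - delta *: c) ->
  sigma * `|c| ^+ 2 <= ip p c ->
  `|a - eta *: (p - q)| ^+ 2 <= `|a| ^+ 2
    - (eta_star alpha beta sigma gamma delta / eta - 1) * `|eta *: (p - q)| ^+ 2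
    - gamma / (2 * eta * sigma)
        * `|eta *: (p - q) - (2 * eta * sigma) *: c| ^+ 2
    - gamma * eta / (2 * delta ^+ 2 * (alpha + beta))
        * `|(1 + delta / gamma - 2 + 2 * delta * alpha) *: p
            + (2 - (1 + delta / gamma) + 2 * delta * beta) *: q| ^+ 2.
Proof.
move=> ab0 s0 g0 d0 e0; rewrite !sqr_normE -subr_ge0 => hA.
rewrite -subr_ge0 => hB; rewrite -subr_ge0 => hC; rewrite -subr_ge0.
set lhs := (X in 0 <= X).
suff -> : lhs = eta * 2 * (ip p a - (1 + gamma * alpha) * ip p p
  + gamma / delta *
    (ip q (- (delta / gamma) *: a + (1 + delta / gamma) *: p - delta *: c)
       - (1 + delta * beta) * ip q q)
  + gamma * (ip p c - sigma * ip c c)).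
  apply: mulr_ge0; first by rewrite mulr_ge0 ?ltW.
  apply: addr_ge0; last by rewrite mulr_ge0 // ltW.
  by apply: addr_ge0; rewrite // mulr_ge0 // ltW // divr_gt0.
rewrite /lhs /eta_star !ipE (ipC q p) (ipC p a) (ipC q a) (ipC p c) (ipC q c).
by field; rewrite !gt_eqF.
Qed.

(** The map [N] is forced by [T = (1 - theta) Id + theta N], and the slack in its nonexpansiveness
    is [theta^-1] times the slack in the hypothesis. *)
Lemma conically_averaged_of_ineq (theta : R) (T : V -> V) (TT : op V) :
  0 < theta -> (forall x y, TT x y <-> y = T x) ->
  (forall x y, `|T x - T y| ^+ 2 <=
     `|x - y| ^+ 2 - (theta^-1 - 1) * `|(x - T x) - (y - T y)| ^+ 2) ->
  conically_averaged theta TT.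
Proof.
move=> t0 TE hT; split=> //.
exists (fun x => x - theta^-1 *: (x - T x)); split=> [x y|x y]; last first.
  rewrite TE; have -> // : (1 - theta) *: x +
      theta *: (x - theta^-1 *: (x - T x)) = T x.
  by apply: ip_ext => z; rewrite !ipE; field; rewrite gt_eqF.
rewrite -(ler_pXn2r (_ : 0 < 2)%N) ?nnegrE //.
have /= u0 := hT x y; rewrite -subr_ge0 !sqr_normE in u0.
rewrite -subr_ge0 !sqr_normE.
set u := (X in is_true (0 <= X)) in u0; set v := (X in 0 <= X).
suff -> : v = theta^-1 * u by apply: mulr_ge0 => //; rewrite invr_ge0 ltW.
rewrite /u /v !ipE (ipC y x) (ipC (T y) (T x)) (ipC (T x) x) (ipC (T y) x).
rewrite (ipC (T x) y) (ipC (T y) y).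
by field; rewrite gt_eqF.
Qed.

(** * Asymptotic centers *)

Lemma sqr_normD_le (t : R) (v w : V) : 0 < t ->
  `|v + w| ^+ 2 <= (1 + t) * `|v| ^+ 2 + (1 + t^-1) * `|w| ^+ 2.
Proof.
move=> t0; rewrite -subr_ge0 !sqr_normE.
set d := (X in 0 <= X).
have -> : d = t^-1 * ip (t *: v - w) (t *: v - w).
  by rewrite /d !ipE (ipC w v); field; rewrite gt_eqF.
by rewrite mulr_ge0 ?ip_ge0 // invr_ge0 ltW.
Qed.

Definition infinitely_many (E : set nat) := forall N, exists2 n, (N <= n)%N & E n.

(* [limsup_{n in E} |u n - b|^2 <= f] *)
Definition limsup_sqr_le (u : nat -> V) (E : set nat) (b : V) (f : R) :=
  forall e : R, 0 < e -> exists N, forall n, (N <= n)%N -> E n ->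
    `|u n - b| ^+ 2 <= f + e.

(** Upper bounds of the limsup inherit strong convexity from [sqr_norm_convex], so
    [strongly_convex_min] applies. That [m] bounds the limsup at [c] itself is then deduced from
    near-minimizers close to [c]. *)
Lemma asymptotic_center (u : nat -> V) (E : set nat) (z : V) (B : R) :
  infinitely_many E -> (forall n, `|u n - z| <= B) ->
  exists c m, limsup_sqr_le u E c m /\
    (forall b f, limsup_sqr_le u E b f -> m + `|b - c| ^+ 2 <= f).
Proof.
move=> Einf uB.
have P_ge0 b f : limsup_sqr_le u E b f -> 0 <= f.
  move=> Pf; apply/ler_addgt0Pr => e /Pf[N hN].
  have [n Nn En] := Einf N.
  exact: le_trans (sqr_ge0 _) (hN n Nn En).
have [|||c [m [hc happ]]] := @strongly_convex_min (limsup_sqr_le u E) 0 => //.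
- move=> b f c g t /andP[t0 t1] Pf Pg e e0.
  have [N hN] := Pf _ e0; have [N' hN'] := Pg _ e0.
  exists (maxn N N') => n; rewrite geq_max => /andP[Nn N'n] En.
  have -> : u n - ((1 - t) *: b + t *: c) = (1 - t) *: (u n - b) + t *: (u n - c).
    by apply: ip_ext => y; rewrite !ipE; ring.
  rewrite sqr_norm_convex (_ : u n - b - (u n - c) = c - b); last first.
    by apply: ip_ext => y; rewrite !ipE; ring.
  rewrite (distrC c b).
  have : (1 - t) * `|u n - b| ^+ 2 <= (1 - t) * (f + e).
    by apply: ler_wpM2l; [lra | exact: hN].
  have : t * `|u n - c| ^+ 2 <= t * (g + e).
    by apply: ler_wpM2l => //; exact: hN'.
  lra.
- exists z, (B ^+ 2) => e e0; exists 0%N => n _ _.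
  by apply: (@le_trans _ _ (B ^+ 2));
    [rewrite lerXn2r ?nnegrE ?(le_trans _ (uB n)) | lra].
have m0 : 0 <= m.
  by apply/ler_addgt0Pr => e /happ[b [f [/P_ge0 f0 /ltW]]]; exact: le_trans.
exists c, m; split=> // e e0.
(* A point [b] of value below [m + t^2] satisfies [|b - c|^2 <= t^2]; Young's inequality with weight
   [t] then bounds [|u n - c|^2] by [m + t (m + 6)]. *)
pose t := e / (m + 6 + e).
have t0 : 0 < t by rewrite divr_gt0 //; lra.
have te : t * (m + 6) <= e.
  by rewrite /t mulrAC ler_pdivrMr ?ler_pM2l //; lra.
have t1 : t <= 1 by rewrite /t ler_pdivrMr; lra.
have tt : t ^+ 2 <= t by rewrite expr2 ler_piMr // ltW.
have ttt : t * t ^+ 2 <= t by rewrite ler_piMr ?(le_trans tt) // ltW.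
have tt0 : 0 < t ^+ 2 by rewrite exprn_gt0.
have [b [f [Pf fm]]] := happ _ tt0.
have bc := hc _ _ Pf.
have [N hN] := Pf _ tt0.
exists N => n Nn En.
have -> : u n - c = (u n - b) + (b - c) by rewrite subrKA.
apply: (le_trans (sqr_normD_le _ _ t0)).
have H1 : (1 + t) * `|u n - b| ^+ 2 <= (1 + t) * (m + t ^+ 2 + t ^+ 2).
  by apply: ler_wpM2l; [lra | apply: le_trans (hN _ Nn En) _; lra].
have H2 : (1 + t^-1) * `|b - c| ^+ 2 <= (1 + t^-1) * t ^+ 2.
  by apply: ler_wpM2l; [rewrite addr_ge0 // invr_ge0 ltW | lra].
have H3 : (1 + t^-1) * t ^+ 2 = t ^+ 2 + t by field; rewrite gt_eqF.
rewrite H3 in H2; lra.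
Qed.

(** * Weak convergence of asymptotically regular nonexpansive iterations *)

Section NonexpansiveIteration.
Variables (T : V -> V) (u : nat -> V) (z : V).
Hypothesis neT : nonexpansive T.
Hypothesis uS : forall n, u n.+1 = T (u n).
Hypothesis zT : T z = z.
Hypothesis u_reg : (fun n => `|u n - u n.+1|) @ \oo --> (0 : R).

Lemma dist_fixpoint_cvg c : T c = c ->
  exists l, (fun n => `|u n - c| ^+ 2) @ \oo --> l /\
            forall n, l <= `|u n - c| ^+ 2.
Proof.
move=> Tc.
have dec : {homo (fun n => `|u n - c| ^+ 2) : n m / (n <= m)%N >-> m <= n}.
  apply/nonincreasing_seqP => n.
  by rewrite lerXn2r ?nnegrE // uS -{1}Tc; exact: neT.
have cv : cvgn (fun n => `|u n - c| ^+ 2).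
  apply: nonincreasing_is_cvgn => //.
  by exists 0 => _ [n _ <-]; exact: sqr_ge0.
by eexists; split; [exact: cv | exact: nonincreasing_cvgn_ge].
Qed.

(** As [|u n - T c| <= |u n - u n.+1| + |u n - c|], the limsup at [T c] is also at most [m], and
    quadratic growth gives [T c = c]. The bound uses [l], which does not involve [E], so that
    centers of different sets can be compared. *)
Lemma asymptotic_center_fixed (E : set nat) : infinitely_many E ->
  exists c, T c = c /\ forall l, (forall n, l <= `|u n - c| ^+ 2) ->
    forall b f, limsup_sqr_le u E b f -> l + `|b - c| ^+ 2 <= f.
Proof.
move=> Einf.
have uB n : `|u n - z| <= `|u 0%N - z|.
  by elim: n => // n IH; apply: le_trans IH; rewrite uS -{1}zT; exact: neT.
have [c [m [Pc hc]]] := asymptotic_center Einf uB.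
exists c; split; last first.
  move=> l hl b f /hc; apply: le_trans; rewrite lerD2r.
  apply/ler_addgt0Pr => e /Pc[N hN]; have [n Nn En] := Einf N.
  exact: le_trans (hl n) (hN n Nn En).
pose B := `|u 0%N - z| + `|z - c|.
have B0 : 0 <= B by rewrite addr_ge0.
have ucB n : `|u n - c| <= B.
  by rewrite -(subrKA z); apply: le_trans (ler_normD _ _) _; rewrite lerD2r.
have PTc : limsup_sqr_le u E (T c) m.
  move=> e e0; have e20 : 0 < e / 2 by lra.
  have [N hN] := Pc _ e20.
  (* With [r <= 1] and [s <= B], [(r + s)^2 <= s^2 + r (1 + 2 B)], so this threshold on [r] costs at
     most [e / 2]. *)
  have d0 : 0 < Num.min 1 (e / 2 / (1 + 2 * B)).
    by rewrite lt_min ltr01 divr_gt0 //; lra.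
  move/cvgn_distP: u_reg => /(_ _ d0)[N' hN'].
  exists (maxn N N') => n; rewrite geq_max => /andP[Nn N'n] En.
  have := hN' _ N'n; rewrite subr0 normr_id lt_min => /andP[r1].
  rewrite ltr_pdivlMr; last lra.
  have := hN _ Nn En.
  have : `|u n - T c| ^+ 2 <= (`|u n - u n.+1| + `|u n - c|) ^+ 2.
    rewrite lerXn2r ?nnegrE ?addr_ge0 //.
    rewrite -(subrKA (u n.+1)); apply: le_trans (ler_normD _ _) _.
    by rewrite lerD2l uS; exact: neT.
  have rc : `|u n - u n.+1| * `|u n - c| <= `|u n - u n.+1| * B.
    by rewrite ler_wpM2l.
  have rr : `|u n - u n.+1| * `|u n - u n.+1| <= `|u n - u n.+1|.
    by rewrite ler_piMr // ltW.
  rewrite sqrrD mulr2n; lra.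
apply/eqP; rewrite -subr_eq0 -normr_eq0 -sqrf_eq0 eq_le sqr_ge0 andbT.
by have := hc _ _ PTc; lra.
Qed.

Lemma nonexpansive_weak_cvg : exists c, T c = c /\ weak_cvg ip u c.
Proof.
have [|c [Tc hc]] := @asymptotic_center_fixed setT; first by move=> N; exists N.
have [l [cl lc]] := dist_fixpoint_cvg Tc.
exists c; split=> // y0.
(* A one-sided bound suffices: it is applied to [y0] and to [- y0]. *)
have half y e : 0 < e -> exists N, forall n, (N <= n)%N -> ip (u n - c) y < e.
  move=> e0; apply: contrapT => hN.
  pose E : set nat := [set n | e <= ip (u n - c) y].
  have Einf : infinitely_many E.
    move=> N; apply: contrapT => hE; apply: hN; exists N => n Nn.
    by rewrite ltNge; apply/negP => en; apply: hE; exists n.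
  have [c' [Tc' hc']] := asymptotic_center_fixed Einf.
  have [l' [cl' lc']] := dist_fixpoint_cvg Tc'.
  have limsup_lim a k F : (fun n => `|u n - a| ^+ 2) @ \oo --> k ->
      limsup_sqr_le u F a k.
    move=> /cvgn_distP ak d /ak[N hN0]; exists N => n /hN0 + _.
    by rewrite ltr_norml; lra.
  have H1 := hc _ lc _ _ (limsup_lim _ _ _ cl').
  have H2 := hc' _ lc' _ _ (limsup_lim _ _ _ cl).
  (* Adding [H1] and [H2] cancels [l] and [l'], so the two centers agree. *)
  have D0 : `|c - c'| = 0.
    apply/eqP; rewrite -sqrf_eq0 eq_le sqr_ge0 andbT.
    have := sqr_ge0 `|c' - c|; lra.
  have cc' : c' = c by apply/eqP; rewrite eq_sym -subr_eq0 -normr_eq0 D0.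
  subst c'; rewrite subrr normr0 expr0n addr0 in H1 H2.
  (* On [E], moving the center by [y] lowers the limit by at least [2 e - |y|^2], while the center
     property forces a growth of [|y|^2]; together these give [2 e <= 0]. *)
  have : limsup_sqr_le u E (c + y) (l - 2 * e + `|y| ^+ 2).
    move=> d /(limsup_lim _ _ E cl)[N hN0]; exists N => n Nn En.
    have := hN0 _ Nn En; have : e <= ip (u n - c) y by [].
    by rewrite !sqr_normE !ipE (ipC y c) (ipC y (u n)) (ipC c (u n)); lra.
  move=> /(hc' _ lc'); rewrite addrAC subrr add0r; lra.
apply/cvgn_distP => e e0.
have [N hN] := half y0 e e0; have [N' hN'] := half (- y0) e e0.
exists (maxn N N') => n; rewrite geq_max => /andP[/hN + /hN'].
by rewrite !ipE ltr_norml; lra.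
Qed.

End NonexpansiveIteration.

(** * The splitting operator, its fixed points and the zeros of the sum *)

Section Splitting.
Variables (A B : op V) (C : V -> V) (alpha beta sigma gamma delta eta : R).
Variables (JA JB : V -> V).
Hypotheses (hA : max_alpha_monotone ip alpha A)
  (hB : max_alpha_monotone ip beta B) (hab : 0 < alpha + beta)
  (hC : cocoercive ip sigma C).
Hypotheses (gamma0 : 0 < gamma) (delta0 : 0 < delta) (eta0 : 0 < eta).
Hypotheses (hJA : has_graph JA (resolvent gamma A))
  (hJB : has_graph JB (resolvent delta B)).

(** Functional forms of the operators, written with the same sums and scalings as [S_op] and [T_op]
    so that the [has_graph] lemmas apply directly. *)
Let lam := 1 + delta / gamma.
Let S x := (1 - lam) *: x + lam *: JA x + (- delta) *: C (JA x).
Let JBS x := JB (S x).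
Let T x := x + (- eta) *: JA x + eta *: JBS x.
Let etas := eta_star alpha beta sigma gamma delta.
Let Z := zer (op_add (op_add A B) (fun_op C)).

Lemma has_graph_JBS :
  has_graph JBS (op_comp (resolvent delta B) (S_op gamma delta A C)).
Proof.
apply: has_graph_comp => //; apply: has_graph_add.
  apply: has_graph_add; apply: has_graph_scale => //.
by apply: has_graph_scale; apply: has_graph_comp.
Qed.

Lemma has_graph_T : has_graph T (T_op gamma delta eta A B C).
Proof.
apply: has_graph_add; last exact: has_graph_scale has_graph_JBS.
by apply: has_graph_add; [| exact: has_graph_scale].
Qed.

Lemma subT x : x - T x = eta *: (JA x - JBS x).
Proof. by apply: ip_ext => w; rewrite !ipE; ring. Qed.

Lemma T_ineq x y : `|T x - T y| ^+ 2 <=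
  `|x - y| ^+ 2
  - (etas / eta - 1) * `|(x - T x) - (y - T y)| ^+ 2
  - gamma / (2 * eta * sigma)
      * `|(x - T x) - (y - T y) - (2 * eta * sigma) *: (C (JA x) - C (JA y))| ^+ 2
  - gamma * eta / (2 * delta ^+ 2 * (alpha + beta))
      * `|(lam - 2 + 2 * delta * alpha) *: (JA x - JA y)
          + (2 - lam + 2 * delta * beta) *: (JBS x - JBS y)| ^+ 2.
Proof.
have [s0 hC'] := hC.
have pA : (1 + gamma * alpha) * `|JA x - JA y| ^+ 2 <= ip (JA x - JA y) (x - y).
  by apply: resolvent_monotone hA.1 gamma0 _ _; exact/hJA.
have pB : (1 + delta * beta) * `|JBS x - JBS y| ^+ 2 <=
    ip (JBS x - JBS y) (S x - S y).
  by apply: resolvent_monotone hB.1 delta0 _ _; exact/hJB.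
(* This expresses the increment of [S] through those of [x], [JA] and [C], the vectors [a], [p] and
   [c] of [splitting_ineq]; [q] is the increment of [JBS]. *)
have SE : S x - S y = - (delta / gamma) *: (x - y) +
    (1 + delta / gamma) *: (JA x - JA y) - delta *: (C (JA x) - C (JA y)).
  by apply: ip_ext => w; rewrite /S /lam !ipE; ring.
rewrite SE in pB.
have := splitting_ineq hab s0 gamma0 delta0 eta0 pA pB (hC' (JA x) (JA y)).
have -> : x - y - eta *: (JA x - JA y - (JBS x - JBS y)) = T x - T y.
  by apply: ip_ext => w; rewrite !ipE; ring.
have -> // : eta *: (JA x - JA y - (JBS x - JBS y)) = (x - T x) - (y - T y).
by apply: ip_ext => w; rewrite !ipE; ring.
Qed.

Let k2 := gamma / (2 * eta * sigma).
Let k3 := gamma * eta / (2 * delta ^+ 2 * (alpha + beta)).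

Lemma k2_gt0 : 0 < k2.
Proof. by have [s0 _] := hC; rewrite divr_gt0 // !mulr_gt0. Qed.

Lemma k3_gt0 : 0 < k3.
Proof. by rewrite divr_gt0 ?mulr_gt0 // exprn_gt0. Qed.

Lemma T_averaged_ineq x y : `|T x - T y| ^+ 2 <=
  `|x - y| ^+ 2 - (etas / eta - 1) * `|(x - T x) - (y - T y)| ^+ 2.
Proof.
apply: le_trans (T_ineq x y) _; rewrite -/k2 -/k3.
set w2 := (X in k2 * `|X| ^+ 2); set w3 := (X in k3 * `|X| ^+ 2).
have := mulr_ge0 (ltW k2_gt0) (sqr_ge0 `|w2|).
have := mulr_ge0 (ltW k3_gt0) (sqr_ge0 `|w3|).
lra.
Qed.

(** For [a] in [A w] and [b] in [B w] with [a + b + C w = 0], take [f = w + gamma a]; then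
    [S f = w + delta b]. *)
Lemma fixpoint_of_zero w : Z w ->
  exists f, [/\ T f = f, JA f = w & JBS f = w].
Proof.
move=> [ab [c [[a [b [Aa [Bb ->]]]] [-> /esym abc]]]].
have JAf : JA (w + gamma *: a) = w.
  by apply/esym/hJA; exists a.
have JBf : JBS (w + gamma *: a) = w.
  apply/esym/hJB; exists b; split=> //.
  have bE : b = - a - C w.
    rewrite -[- a]add0r -abc.
    by apply: ip_ext => v; rewrite !ipE; ring.
  rewrite /S JAf bE; apply: ip_ext => v; rewrite /lam !ipE.
  by field; rewrite gt_eqF.
exists (w + gamma *: a); split=> //.
by apply/eqP; rewrite eq_sym -subr_eq0 subT JAf JBf subrr scaler0.
Qed.

(** With [p] the common shadow, [f = p + gamma a] and [S f = p + delta b]; the definition of [S]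
    also gives [S f = p - delta (a + C p)]. *)
Lemma zero_of_fixpoint f : T f = f -> JA f = JBS f /\ Z (JA f).
Proof.
move=> Tf.
have JE : JA f = JBS f.
  have : eta *: (JA f - JBS f) = 0 by rewrite -subT Tf subrr.
  by move/eqP; rewrite scaler_eq0 gt_eqF //= subr_eq0 => /eqP.
split=> //.
have [a [Aa fE]] : resolvent gamma A f (JA f) by apply/hJA.
have [b [Bb SE]] : resolvent delta B (S f) (JA f) by apply/hJB.
exists (a + b), (C (JA f)); split; first by exists a, b.
split=> //.
suff : delta *: (a + b + C (JA f)) = 0.
  by move/eqP; rewrite scaler_eq0 gt_eqF //= => /eqP.
have dE : delta *: b = S f - JA f by rewrite SE addrC addKr.
rewrite !scalerDr dE /S; move: (JA f) (C (JA f)) fE => p c ->.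
by apply: ip_ext => v; rewrite /lam !ipE; field; rewrite gt_eqF.
Qed.

(** * Residual rate and strong convergence of the shadows *)

Section Convergence.
Variable xs : nat -> V.
Hypothesis xsS : forall n, xs n.+1 = T (xs n).
Hypothesis eta_lt : eta < etas.

Let kappa0 : 0 < etas / eta - 1.
Proof. by rewrite subr_gt0 ltr_pdivlMr // mul1r. Qed.

Lemma T_nonexpansive : nonexpansive T.
Proof.
move=> x y; rewrite -(ler_pXn2r (_ : 0 < 2)%N) ?nnegrE //.
apply: le_trans (T_averaged_ineq x y) _.
by rewrite gerBl mulr_ge0 ?sqr_ge0 // ltW.
Qed.

(** Testing against a fixed point [f] bounds the squared residual by the drop of [|xs n - f|^2];
    nonexpansiveness makes the residuals nonincreasing, as the rate requires. *)
Lemma residual_rate w : Z w ->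
  (fun n => Num.sqrt n%:R * `|xs n - xs n.+1|) @ \oo --> (0 : R) /\
  (fun n => `|xs n - xs n.+1|) @ \oo --> (0 : R).
Proof.
move=> /fixpoint_of_zero[f [Tf _ _]].
have gap n : (etas / eta - 1) * `|xs n - xs n.+1| ^+ 2 <=
    `|xs n - f| ^+ 2 - `|xs n.+1 - f| ^+ 2.
  by have := T_averaged_ineq (xs n) f; rewrite Tf subrr subr0 -xsS; lra.
split; last first.
  by apply: (@cvg0_of_gap _ (fun n => `|xs n - f| ^+ 2) _ _ kappa0 _ _ gap) => n;
    rewrite ?sqr_ge0.
apply: (@sqrt_rate_of_gap _ (fun n => `|xs n - f| ^+ 2)
  (fun n => `|xs n - xs n.+1|) _ kappa0 _ _ _ gap) => n; rewrite ?sqr_ge0 //.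
rewrite {1}xsS (xsS n.+1); exact: T_nonexpansive.
Qed.

(** Telescoping [T_ineq] against [f] sends [d2] and [d3] to 0; with the residual [r], they determine
    the three sequences linearly. *)
Lemma shadow_cvg w : Z w ->
  [/\ (fun n => JA (xs n)) @ \oo --> w, (fun n => JBS (xs n)) @ \oo --> w
    & (fun n => C (JA (xs n))) @ \oo --> C w].
Proof.
move=> Zw; have [_ reg] := residual_rate Zw.
have [f [Tf JAf JBf]] := fixpoint_of_zero Zw.
have [s0 _] := hC.
pose r n := xs n - xs n.+1.
have r0 : r @ \oo --> 0 by apply/norm_cvg0P.
pose d2 n := r n - (2 * eta * sigma) *: (C (JA (xs n)) - C w).
pose d3 n := (lam - 2 + 2 * delta * alpha) *: (JA (xs n) - w)
          + (2 - lam + 2 * delta * beta) *: (JBS (xs n) - w).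
have gap n : k2 * `|d2 n| ^+ 2 + k3 * `|d3 n| ^+ 2 <=
    `|xs n - f| ^+ 2 - `|xs n.+1 - f| ^+ 2.
  have := T_ineq (xs n) f; rewrite Tf subrr subr0 -xsS JAf JBf -/k2 -/k3.
  rewrite -/(r n) -/(d2 n) -/(d3 n).
  have := mulr_ge0 (ltW kappa0) (sqr_ge0 `|r n|); lra.
have d20 : d2 @ \oo --> 0.
  apply/norm_cvg0P; apply: (@cvg0_of_gap _ (fun n => `|xs n - f| ^+ 2) _ k2).
  - exact: k2_gt0.
  - by move=> n; rewrite sqr_ge0.
  - by move=> n; exact: normr_ge0.
  - move=> n; apply: le_trans (gap n); rewrite lerDl.
    by rewrite mulr_ge0 ?sqr_ge0 // ltW // k3_gt0.
have d30 : d3 @ \oo --> 0.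
  apply/norm_cvg0P; apply: (@cvg0_of_gap _ (fun n => `|xs n - f| ^+ 2) _ k3).
  - exact: k3_gt0.
  - by move=> n; rewrite sqr_ge0.
  - by move=> n; exact: normr_ge0.
  - move=> n; apply: le_trans (gap n); rewrite lerDr.
    by rewrite mulr_ge0 ?sqr_ge0 // ltW // k2_gt0.
have rE n : r n = eta *: (JA (xs n) - JBS (xs n)) by rewrite /r xsS subT.
have cvA : (fun n => JA (xs n)) @ \oo --> w.
  (* Replacing [JBS (xs n)] by [JA (xs n) - r n / eta] in [d3] leaves [JA (xs n) - w] with
     coefficient [2 delta (alpha + beta)], which is positive. *)
  have -> : (fun n => JA (xs n)) = (fun n => w +
      (2 * delta * (alpha + beta))^-1 *:
        (d3 n + ((2 - lam + 2 * delta * beta) / eta) *: r n)).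
    apply: funext => n; rewrite /d3 rE; apply: ip_ext => v; rewrite !ipE.
    by field; rewrite !gt_eqF.
  rewrite -[X in _ --> X]addr0 -(scaler0 _ (2 * delta * (alpha + beta))^-1).
  rewrite -[X in _ *: X]addr0 -{2}(scaler0 _ ((2 - lam + 2 * delta * beta) / eta)).
  apply: cvgD; first exact: cvg_cst.
  by apply: cvgZ; [exact: cvg_cst|]; apply: cvgD => //; apply: cvgZ => //;
    exact: cvg_cst.
split=> //.
- have -> : (fun n => JBS (xs n)) = (fun n => JA (xs n) - eta^-1 *: r n).
    by apply: funext => n; rewrite rE scalerA mulVf ?gt_eqF // scale1r subKr.
  rewrite -[X in _ --> X]subr0 -(scaler0 _ eta^-1).
  by apply: cvgB => //; apply: cvgZ => //; exact: cvg_cst.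
- have -> : (fun n => C (JA (xs n))) =
      (fun n => C w + (2 * eta * sigma)^-1 *: (r n - d2 n)).
    apply: funext => n; rewrite /d2 subKr scalerA mulVf ?gt_eqF ?mulr_gt0 //.
    by rewrite scale1r addrC subrK.
  rewrite -[X in _ --> X]addr0 -(scaler0 _ (2 * eta * sigma)^-1).
  rewrite -[X in _ *: X]subr0.
  apply: cvgD; first exact: cvg_cst.
  by apply: cvgZ; [exact: cvg_cst|]; exact: cvgB.
Qed.

End Convergence.
End Splitting.

End InnerProduct.

(** * Assembly of the three claims *)

Unset Implicit Arguments.

Theorem theorem4p5 (R : realType) (V : completeNormedModType R)
  (ip : V -> V -> R) (hip : is_inner_product ip)
  (A B : op V) (C : V -> V) (alpha beta sigma gamma delta eta : R)
  (hA : max_alpha_monotone ip alpha A) (hB : max_alpha_monotone ip beta B)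
  (hab : 0 < alpha + beta) (hC : cocoercive ip sigma C)
  (hgamma : 0 < gamma) (hdelta : 0 < delta) (heta : 0 < eta) :
  let etastar :=
    (4 * gamma * delta * (1 + gamma * alpha) * (1 + delta * beta)
       - (gamma + delta) ^+ 2) / (2 * gamma * delta ^+ 2 * (alpha + beta))
    - gamma / (2 * sigma) in
  let lam := 1 + delta / gamma in
  let JA := resolvent gamma A in
  let JBS := op_comp (resolvent delta B) (S_op gamma delta A C) in
  let T := T_op gamma delta eta A B C in
  let ZABC := zer (op_add (op_add A B) (fun_op C)) in
  0 < etastar ->
  (* (i) *)
  single_valued_full_domain T
  (* (ii) *)
  /\ (forall x y tx ty px py qx qy,
        T x tx -> T y ty -> JA x px -> JA y py -> JBS x qx -> JBS y qy ->
        `|tx - ty| ^+ 2 <=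
          `|x - y| ^+ 2
          - (etastar / eta - 1) * `|(x - tx) - (y - ty)| ^+ 2
          - gamma / (2 * eta * sigma)
              * `|(x - tx) - (y - ty) - (2 * eta * sigma) *: (C px - C py)| ^+ 2
          - gamma * eta / (2 * delta ^+ 2 * (alpha + beta))
              * `|(lam - 2 + 2 * delta * alpha) *: (px - py)
                  + (2 - lam + 2 * delta * beta) *: (qx - qy)| ^+ 2)
  /\ conically_averaged (eta / etastar) T
  (* (iii) *)
  /\ (forall (x0 : V) (xs : nat -> V),
        xs 0%N = x0 -> (forall n, T (xs n) (xs n.+1)) ->
        (exists z, ZABC z) -> eta < etastar ->
        (fun n => Num.sqrt (n%:R : R) * `|xs n - xs n.+1|) @ \oo --> (0 : R)
        /\ exists xstar, Fix T xstar /\ weak_cvg ip xs xstar /\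
           forall (p q : nat -> V) (ps qs : V),
             (forall n, JA (xs n) (p n)) -> (forall n, JBS (xs n) (q n)) ->
             JA xstar ps -> JBS xstar qs ->
             p @ \oo --> ps /\ q @ \oo --> qs /\ ps = qs /\ ZABC ps /\
             (fun n => C (p n)) @ \oo --> C ps /\
             (forall z, ZABC z <-> z = ps)).
Proof.
move=> etastar lam JA JBS T ZABC etastar0.
have [s0 _] := hC.
have [a0 b0] := eta_star_gt0 hab s0 hgamma hdelta etastar0.
have [jA hjA] := resolventE hip hA hgamma a0.
have [jB hjB] := resolventE hip hB hdelta b0.
have hJBS := has_graph_JBS C hjA hjB.
have hT := has_graph_T C eta hjA hjB.
split; [|split; [|split]].
- by move=> x; eexists; split; [exact/hT | move=> y /hT].
- move=> x y tx ty px py qx qy /hT -> /hT -> /hjA -> /hjA -> /hJBS -> /hJBS ->.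
  exact: (T_ineq hip hA hB hab hC hgamma hdelta heta hjA hjB).
- apply: (conically_averaged_of_ineq hip _ hT).
    by rewrite divr_gt0.
  move=> x y; rewrite invf_div.
  exact: (T_averaged_ineq hip hA hB hab hC hgamma hdelta heta hjA hjB).
move=> x0 xs _ xsT [z Zz] eta_lt.
have xsS n := (hT _ _).1 (xsT n).
have [rate reg] := residual_rate hip hA hB hab hC
  hgamma hdelta heta hjA hjB xsS eta_lt Zz.
split=> //.
have neT := T_nonexpansive hip hA hB hab hC
  hgamma hdelta heta hjA hjB eta_lt.
have [f [Tf _ _]] := fixpoint_of_zero hip eta hgamma hjA hjB Zz.
have [c [Tc xc]] := nonexpansive_weak_cvg hip neT xsS Tf reg.
have [JE Zc] := zero_of_fixpoint hip hgamma hdelta heta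
  hjA hjB Tc.
have shadow := shadow_cvg hip hA hB hab hC
  hgamma hdelta heta hjA hjB xsS eta_lt.
exists c; split; first by apply/hT; rewrite Tc.
split=> // p q ps qs hp hq /hjA -> /hJBS ->.
have -> := funext (fun n => (hjA _ _).1 (hp n)).
have -> := funext (fun n => (hJBS _ _).1 (hq n)).
have [cA cB cC] := shadow _ Zc.
(* The shadows converge to every zero, so uniqueness of limits leaves only one. *)
rewrite -JE; do 5 ![split=> //]; move=> w; split=> [/shadow[cw _ _]|-> //].
exact: cvg_unique cw cA.
Qed.
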